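(* Suppose permutations $\sigma<\tau$ satisfy $|\tau|-|\sigma|\ge 3$. Then the open interval $(\sigma,\tau)$ is disconnected if and only if the embeddings of $\sigma$ in $\tau$ can be partitioned into two nonempty sets $E_1$ and $E_2$ with the following properties: (a) $S_1\cap S_2=\emptyset$, where $S_i$ is the union of the zero sets of the elements of $E_i$; (b) for all $\eta_1\in E_1$ with zero set $Z_1$, and all $\eta_2\in E_2$ with zero set $Z_2$, there do not exist $z_1\in Z_1$ and $z_2\in Z_2$ such that $$\tau-(Z_1\setminus\{z_1\})=\tau-(Z_2\setminus\{z_2\}).$$ Furthermore, the nature of the resulting disconnection is that the elements of $(\sigma,\tau)$ of the form $\tau-S_1'$ for $S_1'\subseteq S_1$ are disconnected from those of the form $\tau-S_2'$ for $S_2'\subseteq S_2$.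
   Context: The permutation pattern poset $\mathcal{P}$ is the set of all permutations of $\{1,\dots,n\}$, $n>0$ (written as words), ordered by pattern containment: $\sigma\le\tau$ if $\tau$ has a subsequence (an occurrence of $\sigma$) whose letters appear in the same relative order of size as those of $\sigma$. $|\pi|$ is the length of $\pi$. $(\sigma,\tau)=\{\pi:\sigma<\pi<\tau\}$; it is disconnected if its order complex (simplicial complex of chains) is disconnected, i.e. it is the disjoint union of two nonempty subsets with no element of one comparable to an element of the other. Two sets of elements of $(\sigma,\tau)$ are disconnected from each other if no element of one is connected to an element of the other through a sequence of successively comparable elements of $(\sigma,\tau)$. For $\sigma\le\tau$ with $|\sigma|=k$, an embedding $\eta$ of $\sigma$ in $\tau$ is a sequence $\eta=(0,\dots,0,\sigma(1),0,\dots,0,\sigma(2),0,\dots,0,\sigma(k),0,\dots,0)$ of length $|\tau|$ whose nonzero positions are the positions of an occurrence of $\sigma$ in $\tau$. The zero set of $\eta$ is the set of positions at which $\eta$ is zero. For $Z\subseteq\{1,\dots,|\tau|\}$, $\tau-Z$ is the permutation obtained by deleting the letters of $\tau$ in the positions in $Z$ and then flattening, i.e. replacing the remaining word by the permutation of $\{1,\dots,|\tau|-|Z|\}$ with letters in the same relative order. *)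

(* Defs.v *)
From HB Require Import structures.
From mathcomp Require Import all_boot all_order.

Set Implicit Arguments.
Unset Strict Implicit.
Unset Printing Implicit Defensive.

(* Positions in a word are numbered from 0, as ['I_(size w)], whereas the
   letters of a permutation of length n are 1, ..., n.                        *)

Definition subword (w : seq nat) (A : {set 'I_(size w)}) : seq nat :=
  [seq nth 0 w (val i) | i <- enum A].

Definition order_iso (u v : seq nat) : bool :=
  (size u == size v) &&
  [forall i : 'I_(size u), forall j : 'I_(size u),
     (nth 0 u i < nth 0 u j) == (nth 0 v i < nth 0 v j)].

(* The letter x is replaced by its rank among the letters of w (meaningful
   when the letters of w are distinct).                                       *)
Definition flattening (w : seq nat) : seq nat :=
  [seq count (fun y => y <= x) w | x <- w].

Definition is_permutation (w : seq nat) : bool :=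
  (0 < size w) && perm_eq w (iota 1 (size w)).

Record permutation : Type := Permutation {
  word :> seq nat;
  wordP : is_permutation word
}.

HB.instance Definition _ := [isSub for word].
HB.instance Definition _ := [Choice of permutation by <:].

Definition occurs_at (sigma tau : seq nat) (A : {set 'I_(size tau)}) : bool :=
  order_iso (subword A) sigma.

Definition pattern_le (sigma tau : permutation) : bool :=
  [exists A : {set 'I_(size tau)}, occurs_at sigma A].

Lemma order_isoP (u v : seq nat) :
  reflect (size u = size v /\ forall i j, i < size u -> j < size u ->
             (nth 0 u i < nth 0 u j) = (nth 0 v i < nth 0 v j))
          (order_iso u v).
Proof.
apply: (iffP andP) => [[/eqP Euv /forallP uv]|[Euv uv]].
  split=> // i j ltiu ltju.
  by have /forallP/(_ (Ordinal ltju))/eqP := uv (Ordinal ltiu).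
by split; [apply/eqP | apply/forallP=> i; apply/forallP=> j; apply/eqP/uv].
Qed.

Lemma mask_nth (m : bitseq) (u : seq nat) :
  mask m u = [seq nth 0 u i | i <- mask m (iota 0 (size u))].
Proof. by rewrite map_mask -/(mkseq _ _) mkseq_nth. Qed.

Lemma order_iso_mask (m : bitseq) (u v : seq nat) :
  order_iso u v -> order_iso (mask m u) (mask m v).
Proof.
case/order_isoP=> Euv uv; apply/order_isoP; rewrite (mask_nth m u) (mask_nth m v) -Euv.
set s := mask m _; rewrite !size_map; split=> // i j lti ltj.
have s_lt k : k < size s -> nth 0 s k < size u.
  move=> ltk; have /mem_mask : nth 0 s k \in s by rewrite mem_nth.
  by rewrite mem_iota.
by rewrite !(nth_map 0) // uv ?s_lt.
Qed.

Lemma order_iso_trans : transitive order_iso.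
Proof.
move=> v u w /order_isoP[Euv uv] /order_isoP[Evw vw].
apply/order_isoP; split=> [|i j lti ltj]; first by rewrite Euv.
by rewrite uv // vw // -Euv.
Qed.

Lemma order_iso_eq (s t : permutation) : order_iso s t -> s = t.
Proof.
have rank (w : permutation) i : i < size w ->
    nth 0 w i = (count (fun j => nth 0 w j < nth 0 w i) (iota 0 (size w))).+1.
  case: w => w /= /andP[_ w_perm] lti.
  have xw : nth 0 w i \in iota 1 (size w).
    by rewrite -(perm_mem w_perm) mem_nth.
  set x := nth 0 w i in xw *.
  rewrite -(count_map (nth 0 w) (fun y => y < x)) -/(mkseq _ _) mkseq_nth.
  move/permP: w_perm => ->; move: xw; rewrite mem_iota add1n ltnS.
  move: x (size w) => [//|x] n /andP[_ lexn].
  rewrite -(subnKC (ltnW lexn)) iotaD count_cat.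
  have -> : count (fun y => y < x.+1) (iota 1 x) = x.
    rewrite -[RHS](size_iota 1); apply/eqP; rewrite -all_count.
    by apply/allP=> y; rewrite mem_iota add1n => /andP[].
  rewrite (@eq_in_count _ _ pred0) ?count_pred0 ?addn0 //.
  by move=> y; rewrite mem_iota add1n => /andP[ltxy _]; rewrite ltnNge ltxy.
case/order_isoP=> Est st; apply/val_inj/(@eq_from_nth _ 0)=> // i lti.
rewrite (rank s i) // (rank t i) -?Est //; congr _.+1; apply: eq_in_count => j.
by rewrite mem_iota => ltj; rewrite st.
Qed.

Lemma subword_subseq (w : seq nat) (A : {set 'I_(size w)}) :
  subseq (subword A) w.
Proof.
rewrite /subword -[X in subseq _ X](mkseq_nth 0) /mkseq -val_enum_ord -map_comp.
by apply: map_subseq; rewrite [enum A]/(enum_mem _) -enumT filter_subseq.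
Qed.

Lemma subseq_subword (u w : seq nat) :
  subseq u w -> exists A : {set 'I_(size w)}, subword A = u.
Proof.
case/subseqP=> m Em ->; exists [set i | nth false m (val i)].
rewrite mask_nth -val_enum_ord -map_mask -map_comp /subword; congr map.
rewrite [enum _]/(enum_mem _) -enumT filter_mask; congr mask.
apply: (@eq_from_nth _ false); rewrite size_map size_enum_ord // => i lti.
by rewrite (nth_map (Ordinal lti)) ?size_enum_ord //= inE nth_enum_ord.
Qed.

Lemma pattern_leP (s t : permutation) :
  reflect (exists2 u, subseq u t & order_iso u s) (pattern_le s t).
Proof.
apply: (iffP existsP) => [[A As]|[u /subseq_subword[A <-]]]; last by exists A.
by exists (subword A); first exact: subword_subseq.
Qed.

Lemma pattern_le_refl : reflexive pattern_le.
Proof. by move=> s; apply/pattern_leP; exists s => //; apply/order_isoP. Qed.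

Lemma pattern_le_anti : antisymmetric pattern_le.
Proof.
move=> s t /andP[/pattern_leP[u ut us] /pattern_leP[v vs vt]].
have [/order_isoP[Eus _] /order_isoP[Evt _]] := (us, vt).
apply/esym/order_iso_eq; suff <- : u = t by [].
apply/eqP; rewrite -(size_subseq_leqif ut) eqn_leq size_subseq //=.
by rewrite Eus -Evt size_subseq.
Qed.

Lemma pattern_le_trans : transitive pattern_le.
Proof.
move=> s r t /pattern_leP[_ /subseqP[m Em ->] vr] /pattern_leP[u ut us].
apply/pattern_leP; exists (mask m u).
  exact: subseq_trans (mask_subseq m u) ut.
exact: order_iso_trans (order_iso_mask m us) vr.
Qed.

Fact pattern_display : Order.disp_t. Proof. exact: Order.Disp tt tt. Qed.

HB.instance Definition _ := Order.Le_isPOrder.Build pattern_display permutation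
  pattern_le_refl pattern_le_anti pattern_le_trans.

(* tau - Z *)
Definition delete (tau : seq nat) (Z : {set 'I_(size tau)}) : seq nat :=
  flattening (subword (~: Z)).

(* The sequences of length |tau| with entries in {0, ..., |sigma|}.           *)
Definition eseq (sigma tau : permutation) : finType :=
  (size tau).-tuple 'I_(size sigma).+1.

Section Embeddings.
Variables sigma tau : permutation.
Implicit Types (eta : eseq sigma tau) (E : {set eseq sigma tau}).

Definition zero_set eta : {set 'I_(size tau)} :=
  [set i | tnth eta i == ord0].

Definition embeddings : {set eseq sigma tau} :=
  [set eta : eseq sigma tau |
     ([seq val x | x <- tval eta & x != ord0] == word sigma)
     && occurs_at sigma (~: zero_set eta)].

Definition zero_union E : {set 'I_(size tau)} :=
  \bigcup_(eta in E) zero_set eta.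

Definition splitting E1 E2 : Prop :=
  [/\ [/\ E1 != set0, E2 != set0, E1 :&: E2 = set0 & E1 :|: E2 = embeddings],
      zero_union E1 :&: zero_union E2 = set0
    & forall eta1 eta2, eta1 \in E1 -> eta2 \in E2 ->
        ~ exists z1 z2, [/\ z1 \in zero_set eta1, z2 \in zero_set eta2
            & delete (zero_set eta1 :\ z1) = delete (zero_set eta2 :\ z2)]].

End Embeddings.

Section Intervals.
Local Open Scope order_scope.
Variables sigma tau : permutation.

Definition open_interval : pred permutation := [pred x | sigma < x < tau].

Definition disconnected_interval : Prop :=
  exists A B : permutation -> Prop,
    [/\ (exists x, A x) /\ (exists y, B y),
        forall x, ~ (A x /\ B x),
        forall x, x \in open_interval <-> A x \/ B x
      & forall x y, A x -> B y -> x >< y].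

Definition connected_in (x y : permutation) : Prop :=
  exists p : seq permutation,
    [/\ all open_interval (x :: p), path (fun a b => a >=< b) x p
      & last x p = y].

Definition disconnected_from (A B : permutation -> Prop) : Prop :=
  forall x y, A x -> B y -> ~ connected_in x y.

Definition deletions_from (S : {set 'I_(size tau)}) (x : permutation) : Prop :=
  x \in open_interval /\
  exists2 S' : {set 'I_(size tau)}, S' \subset S & word x = delete S'.

End Intervals.

(* Main.v *)
Require Import Defs.
From HB Require Import structures.
From mathcomp Require Import all_boot all_order.

(** Every permutation pi <= tau is tau - W for a set W of positions, and every
    occurrence of a permutation rho <= tau - W enlarges W to a set V with
    tau - V = rho (lemma [deletion_lift]).  Starting from W = set0, this shows
    that the elements of the open interval (sigma, tau) are exactly the tau - W
    with W nonempty and properly contained in the zero set of an embedding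
    ([in_intervalP]).  So the interval is the union of the images of the proper
    parts of Boolean lattices, one for each embedding; call the image for eta
    the block of eta.

    If the interval is the union of two parts with no comparabilities between
    them, each block lies in one part: for distinct positions i, j in a zero
    set Z, both tau - {i} and tau - {j} lie above tau - {i, j}, which is in the
    interval because |Z| >= 3.  Sorting the embeddings by the part of their
    block gives E1 and E2.  A position common to S1 and S2, or an equality
    forbidden by (b), would be an element common to both parts.

    Conversely, let E1, E2 satisfy (a) and (b), and suppose that x <= y with
    x = tau - W1 in the block of eta1 in E1 and y = tau - W2 in the block of
    some element of E2.  Going down inside the block of eta1, one reaches
    x' = tau - (Z1 minus z1) <= x, of length |sigma| + 1.  As x' <= y, the set
    W2 extends to a set V with tau - V = x', and V to the zero set Z of an
    embedding, with one more element.  Now Z contains W2, which is a nonempty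
    part of S2, so by (a) this embedding is in E2, and the two expressions of
    x' contradict (b).  The other order is symmetric, so no element of a block
    of E1 is comparable to one of a block of E2 ([splitting_incomparable]).
    The same use of (a) puts every tau - S' with S' contained in S_i in a block
    of E_i. *)

Set Implicit Arguments.
Unset Strict Implicit.
Unset Printing Implicit Defensive.

Import Order.TTheory.

(** * Order isomorphism, flattening and subwords *)

Lemma order_iso_sym (u v : seq nat) : order_iso u v -> order_iso v u.
Proof.
case/order_isoP=> Euv uv; apply/order_isoP; split=> // i j.
by rewrite -Euv => lti ltj; rewrite uv.
Qed.

Lemma permutation_uniq (s : permutation) : uniq s.
Proof.
by case: s => w /= /andP[_ /perm_uniq ->]; apply: iota_uniq.
Qed.

Lemma permutation_size_gt0 (s : permutation) : 0 < size s.
Proof. by case: s => w /= /andP[]. Qed.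

Lemma mem_permutation (s : permutation) x : (x \in word s) = (0 < x <= size s).
Proof.
by case: s => w /= /andP[_ /perm_mem ->]; rewrite mem_iota add1n ltnS.
Qed.

Lemma size_flattening w : size (flattening w) = size w.
Proof. exact: size_map. Qed.

Lemma rank_lt (w : seq nat) x y : y \in w ->
  (count (fun z => z <= x) w < count (fun z => z <= y) w) = (x < y).
Proof.
move=> yw; case: (ltnP x y) => [ltxy|leyx]; last first.
  by apply/negbTE; rewrite -leqNgt; apply: sub_count => z /leq_trans; apply.
have [w1 [w2 ->]] : exists w1 w2, w = w1 ++ y :: w2.
  by case/splitPr: yw => w1 w2; exists w1, w2.
have le_count (s : seq nat) :
    count (fun z => z <= x) s <= count (fun z => z <= y) s.
  by apply: sub_count => z /leq_trans; apply; apply: ltnW.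
rewrite !count_cat /= leqnn (leqNgt y x) ltxy /= add0n add1n addnS ltnS.
exact: leq_add.
Qed.

Lemma flattening_iso w : order_iso (flattening w) w.
Proof.
apply/order_isoP; rewrite size_flattening; split=> // i j lti ltj.
by rewrite !(nth_map 0) // rank_lt ?mem_nth.
Qed.

Lemma flattening_permutation w :
  0 < size w -> uniq w -> is_permutation (flattening w).
Proof.
move=> w_gt0 Uw; rewrite /is_permutation size_flattening w_gt0 /=.
have Uf : uniq (flattening w).
  rewrite map_inj_in_uniq // => x y xw yw Exy; case: (ltngtP x y) => // lt.
    by have := rank_lt x yw; rewrite lt Exy ltnn.
  by have := rank_lt y xw; rewrite lt Exy ltnn.
have sub : {subset flattening w <= iota 1 (size w)}.
  move=> _ /mapP[x xw ->]; rewrite mem_iota add1n ltnS count_size andbT.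
  by rewrite -has_count; apply/hasP; exists x.
apply: uniq_perm => //; first exact: iota_uniq.
by have [|_] := uniq_min_size Uf sub; rewrite ?size_iota ?size_flattening.
Qed.

Lemma size_subword (w : seq nat) (A : {set 'I_(size w)}) :
  size (subword A) = #|A|.
Proof. by rewrite size_map -cardE. Qed.

Lemma subword_subset (w : seq nat) (A B : {set 'I_(size w)}) :
  A \subset B -> subseq (subword A) (subword B).
Proof.
move=> sAB; apply: map_subseq.
rewrite [enum A]/(enum_mem _) (_ : filter _ _ = filter [in A] (enum B)).
  exact: filter_subseq.
rewrite [enum B]/(enum_mem _) -filter_predI; apply: eq_filter => x /=.
by apply/esym/andb_idr/(subsetP sAB).
Qed.

Lemma mask_subword (w : seq nat) (A : {set 'I_(size w)}) m :
  exists2 B : {set 'I_(size w)}, B \subset A & subword B = mask m (subword A).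
Proof.
exists [set x in mask m (enum A)].
  by apply/subsetP=> x; rewrite inE => /mem_mask; rewrite mem_enum.
rewrite /subword -map_mask; congr map.
have sub : subseq (mask m (enum A)) (enum 'I_(size w)).
  apply: subseq_trans (mask_subseq _ _) _.
  by rewrite [enum A]/(enum_mem _) -enumT filter_subseq.
move: (mask m _) sub => s sub.
rewrite [RHS](subseq_uniqP (enum_uniq _) sub) [LHS]/(enum_mem _) -enumT.
by apply: eq_filter => x; rewrite /= inE.
Qed.

(** * Deletions as elements of the pattern poset *)

Section Deletions.
Variable tau : permutation.
Implicit Types (Z W V : {set 'I_(size tau)}) (rho : permutation).

Lemma size_delete Z : size (delete Z) = size tau - #|Z|.
Proof. by rewrite size_flattening size_subword cardsCs setCK card_ord. Qed.

Lemma delete_permutation Z : Z != setT -> is_permutation (delete Z).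
Proof.
move=> ZnT; apply: flattening_permutation.
  by rewrite size_subword card_gt0 -setCT (inj_eq (@setC_inj _)).
exact: subseq_uniq (subword_subseq _) (permutation_uniq tau).
Qed.

(** Deleting every letter gives the empty word, which is not a permutation;
    the default value tau is used then. *)
Definition deletion Z : permutation := insubd tau (delete Z).

Lemma word_deletion Z : Z != setT -> word (deletion Z) = delete Z.
Proof. by move/delete_permutation=> permZ; rewrite [LHS]insubdK. Qed.

Lemma deletionE Z rho :
  word rho = delete Z -> Z != setT /\ rho = deletion Z.
Proof.
move=> Erho; have ZnT : Z != setT.
  apply/eqP=> EZ; have := permutation_size_gt0 rho.
  by rewrite Erho size_delete EZ cardsT card_ord subnn.
by split=> //; apply: val_inj; rewrite /= word_deletion.
Qed.

Lemma deletion_iso Z : Z != setT -> order_iso (deletion Z) (subword (~: Z)).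
Proof. by move/word_deletion->; apply: flattening_iso. Qed.

Lemma occurs_deletion Z rho :
  order_iso (subword (~: Z)) rho -> Z != setT /\ rho = deletion Z.
Proof.
move=> isoZ; have ZnT : Z != setT.
  apply/eqP=> EZ; have := permutation_size_gt0 rho.
  by case/order_isoP: isoZ => <- _; rewrite size_subword EZ setCT cards0.
split=> //; apply/esym/order_iso_eq/order_iso_trans/isoZ.
exact: deletion_iso.
Qed.

Lemma deletion0 : deletion set0 = tau.
Proof.
have [|_ <- //] := @occurs_deletion set0 tau; rewrite setC0.
suff -> : subword [set: 'I_(size tau)] = tau by apply/order_isoP.
apply/eqP; rewrite -(size_subseq_leqif (subword_subseq _)).
by rewrite size_subword cardsT card_ord.
Qed.

Lemma deletion_le Z W : Z != setT -> W \subset Z ->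
  (deletion Z <= deletion W)%O.
Proof.
move=> ZnT sWZ; have WnT : W != setT.
  by apply: contraNneq ZnT => EW; rewrite -subTset -EW.
have [m Em Emask] : exists2 m, size m = size (subword (~: W)) &
    subword (~: Z) = mask m (subword (~: W)).
  by apply/subseqP/subword_subset; rewrite setCS.
apply/pattern_leP; exists (mask m (deletion W)); first exact: mask_subseq.
apply: order_iso_trans (order_iso_sym (deletion_iso ZnT)).
by rewrite Emask; apply/order_iso_mask/deletion_iso.
Qed.

Lemma deletion_lt Z W : Z != setT -> W \proper Z ->
  (deletion Z < deletion W)%O.
Proof.
move=> ZnT pWZ; rewrite lt_neqAle deletion_le ?proper_sub // andbT.
have WnT : W != setT.
  by apply: contraNneq ZnT => EW; rewrite -subTset -EW proper_sub.
apply/negP=> /eqP/(congr1 (fun s : permutation => size s)).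
rewrite !word_deletion // !size_delete.
have := proper_card pWZ; have := max_card Z.
by rewrite card_ord => leZ ltWZ E; move: (ltn_sub2l (leq_trans ltWZ leZ) ltWZ);
  rewrite E ltnn.
Qed.

(** An occurrence of rho in tau - W is an occurrence of rho in tau that avoids
    the positions in W. *)
Lemma deletion_lift W rho : W != setT -> (rho <= deletion W)%O ->
  exists V, [/\ W \subset V, V != setT & rho = deletion V].
Proof.
move=> WnT /pattern_leP[_ /subseqP[m _ ->] iso_rho].
have [A sAW EA] := mask_subword (~: W) m.
exists (~: A); have [|VnT ->] := @occurs_deletion (~: A) rho.
  rewrite setCK EA; apply: order_iso_trans iso_rho.
  exact: order_iso_mask (order_iso_sym (deletion_iso WnT)).
by split=> //; rewrite -setCS setCK.
Qed.

End Deletions.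

(** * Embeddings and the elements of the open interval *)

Section Interval.
Variables sigma tau : permutation.
Implicit Types (eta : eseq sigma tau) (E : {set eseq sigma tau}).
Implicit Types (Z W : {set 'I_(size tau)}) (x y : permutation).

Lemma embedding_deletion eta : eta \in embeddings sigma tau ->
  zero_set eta != setT /\ sigma = deletion (zero_set eta).
Proof. by rewrite inE => /andP[_]; apply: occurs_deletion. Qed.

(** The embedding places at the i-th position outside Z the i-th letter of
    sigma. *)
Lemma deletion_embedding Z : Z != setT -> sigma = deletion Z ->
  exists2 eta, eta \in embeddings sigma tau & zero_set eta = Z.
Proof.
move=> ZnT EZ; set s := enum (~: Z).
have size_s : size s = size sigma.
  by rewrite -cardE -size_subword EZ word_deletion // size_flattening.
pose f i := nth 0 sigma (index i s).
have f_letter i : i \notin Z -> 0 < f i <= size sigma.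
  move=> iZ; rewrite -mem_permutation mem_nth // -size_s index_mem.
  by rewrite mem_enum inE.
pose g i : 'I_(size sigma).+1 := if i \in Z then ord0 else inord (f i).
have valg i : i \notin Z -> val (g i) = f i.
  move=> iZ; rewrite /g (negbTE iZ) /= inordK // ltnS.
  by case/andP: (f_letter i iZ).
have g0 i : (g i == ord0) = (i \in Z).
  case: (boolP (i \in Z)) => iZ; first by rewrite /g iZ eqxx.
  by apply/negbTE; rewrite -val_eqE /= valg // -lt0n; case/andP: (f_letter i iZ).
pose eta : eseq sigma tau := [tuple g i | i < size tau].
have Ezero : zero_set eta = Z by apply/setP=> i; rewrite inE tnth_mktuple g0.
exists eta => //; rewrite inE Ezero; apply/andP; split; last first.
  by rewrite EZ /occurs_at; apply/order_iso_sym/deletion_iso.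
have -> : [seq x <- eta | x != ord0] = [seq g i | i <- s].
  rewrite /= filter_map; congr map.
  rewrite /s [enum (~: Z)]/(enum_mem _) -enumT; apply: eq_filter => i /=.
  by rewrite g0 inE.
rewrite -map_comp; apply/eqP/(@eq_from_nth _ 0); rewrite size_map //.
move=> i lti; have i0 : 'I_(size tau) by case: (s) lti => [//|i0].
have iZ : nth i0 s i \notin Z.
  by have := mem_nth i0 lti; rewrite mem_enum inE.
by rewrite (nth_map i0) //= valg // /f index_uniq ?enum_uniq.
Qed.

Lemma card_zero_set eta : eta \in embeddings sigma tau ->
  #|zero_set eta| = size tau - size sigma.
Proof.
case/embedding_deletion=> ZnT /(congr1 (fun s : permutation => size s)).
rewrite word_deletion // size_delete => ->; rewrite subKn //.
by have := max_card (zero_set eta); rewrite card_ord.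
Qed.

Lemma deletion_in_interval eta W : eta \in embeddings sigma tau ->
  W != set0 -> W \proper zero_set eta ->
  W != setT /\ deletion W \in open_interval sigma tau.
Proof.
case/embedding_deletion=> ZnT Esigma Wn0 pW.
have WnT : W != setT.
  by apply: contraNneq ZnT => EW; rewrite -subTset -EW proper_sub.
split=> //; rewrite inE {1}Esigma deletion_lt //=.
by rewrite -{2}(deletion0 tau) deletion_lt // proper0.
Qed.

(** The union of the images in the interval of the proper parts of the Boolean
    lattices of subsets of the zero sets of the embeddings in E. *)
Definition block E x : Prop := exists eta W,
  [/\ eta \in E, W != set0, W \proper zero_set eta & x = deletion W].

Lemma embedding_above W :
  W != setT -> (sigma <= deletion W)%O ->
  exists2 eta, eta \in embeddings sigma tau & W \subset zero_set eta.
Proof.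
move=> WnT /(deletion_lift WnT)[Z [sWZ ZnT EZ]].
by have [eta etaE EZeta] := deletion_embedding ZnT EZ; exists eta; rewrite ?EZeta.
Qed.

Lemma in_intervalP x :
  x \in open_interval sigma tau <-> block (embeddings sigma tau) x.
Proof.
split=> [|[eta [W [etaE Wn0 pW ->]]]]; last first.
  by case: (deletion_in_interval etaE Wn0 pW).
rewrite inE => /andP[ltsx ltxt].
have nT0 : set0 != [set: 'I_(size tau)].
  by rewrite eq_sym -card_gt0 cardsT card_ord permutation_size_gt0.
have := ltW ltxt; rewrite -[leRHS]deletion0 => /(deletion_lift nT0).
case=> W [_ WnT Ex].
have := ltW ltsx; rewrite Ex => /(embedding_above WnT)[eta etaE sW].
exists eta, W; split=> //.
  by apply: contraTneq ltxt => W0; rewrite Ex W0 deletion0 ltxx.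
rewrite properEneq sW andbT; apply: contraTneq ltsx => EW.
by have [_ ->] := embedding_deletion etaE; rewrite Ex EW ltxx.
Qed.

(** * From a splitting to a disconnection *)

Lemma splitting_sym E1 E2 : splitting E1 E2 -> splitting E2 E1.
Proof.
case=> [[nE1 nE2 I12 U12] S12 neq12]; split.
- by split=> //; rewrite ?(setIC E2) ?(setUC E2).
- by rewrite setIC.
move=> eta2 eta1 E2eta E1eta [z2 [z1 [Z2z Z1z E]]].
by apply: (neq12 eta1 eta2) => //; exists z1, z2.
Qed.

Lemma splitting_sub E1 E2 eta : splitting E1 E2 ->
  eta \in E1 -> eta \in embeddings sigma tau.
Proof. by case=> [[_ _ _ <-] _ _]; rewrite inE => ->. Qed.

(** An embedding outside E2 is in E1, so its zero set would lie in S1 and be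
    disjoint from S2. *)
Lemma splitting_side E1 E2 eta i : splitting E1 E2 ->
  eta \in embeddings sigma tau -> i \in zero_set eta ->
  i \in zero_union E2 -> eta \in E2.
Proof.
case=> [[_ _ _ <-] S12 _]; rewrite inE => /orP[E1eta|//] etai S2i.
have : i \in zero_union E1 :&: zero_union E2.
  by rewrite inE S2i andbT; apply/bigcupP; exists eta.
by rewrite S12 inE.
Qed.

Lemma splitting_not_le E1 E2 x y : splitting E1 E2 ->
  block E1 x -> block E2 y -> ~ (x <= y)%O.
Proof.
move=> sE [eta1 [W1 [E1eta W1n0 pW1 ->]]] [eta2 [W2 [E2eta W2n0 pW2 ->]]] le12.
have eta1E := splitting_sub sE E1eta.
have eta2E := splitting_sub (splitting_sym sE) E2eta.
have [sW1 [z1 Z1z nW1z]] := properP pW1.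
(* The element x' of the block of eta1, below x and of length |sigma| + 1. *)
set V1 := zero_set eta1 :\ z1.
have pV1 : V1 \proper zero_set eta1 by rewrite properD1.
have sWV1 : W1 \subset V1.
  by rewrite subsetD1 sW1.
have V1n0 : V1 != set0.
  by apply: contraNneq W1n0 => V10; rewrite -subset0 -V10.
have [V1nT] := deletion_in_interval eta1E V1n0 pV1.
rewrite inE => /andP[ltsx _].
have le' := le_trans (deletion_le V1nT sWV1) le12.
have [W2nT _] := deletion_in_interval eta2E W2n0 pW2.
have [V [sWV VnT EV]] := deletion_lift W2nT le'.
have [|eta etaE sV] := @embedding_above V VnT; first by rewrite -EV ltW.
have [i W2i] := set0Pn _ W2n0.
have E2eta' : eta \in E2.
  apply: (splitting_side (i := i) sE etaE).
    by rewrite (subsetP sV) ?(subsetP sWV).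
  by apply/bigcupP; exists eta2; rewrite ?(subsetP (proper_sub pW2)).
have Edel : delete V1 = delete V by rewrite -!word_deletion // EV.
have cardV : #|V| = #|V1|.
  have := congr1 size Edel; rewrite !size_delete => Esub.
  have leV := max_card V; have leV1 := max_card V1.
  rewrite !card_ord in leV leV1.
  by rewrite -(subKn leV) -Esub subKn.
have cardZ : #|zero_set eta| = #|V1|.+1.
  rewrite card_zero_set // -(card_zero_set eta1E).
  by rewrite (cardsD1 z1 (zero_set eta1)) Z1z.
have [z2 Ez2] : exists z2, zero_set eta :\: V = [set z2].
  apply/cards1P; rewrite cardsD (setIidPr sV) cardZ cardV.
  by rewrite subSn ?subnn.
have Zz2 : z2 \in zero_set eta :\: V by rewrite Ez2 set11.
case: sE => _ _ /(_ eta1 eta E1eta E2eta'); apply; exists z1, z2.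
split=> //; first by move: Zz2; rewrite inE => /andP[].
by rewrite -/V1 Edel -Ez2 setDDr setDv set0U (setIidPr sV).
Qed.

Lemma splitting_incomparable E1 E2 x y : splitting E1 E2 ->
  block E1 x -> block E2 y -> (x >< y)%O.
Proof.
move=> sE Bx By; apply/negP=> /orP[].
  exact: splitting_not_le sE Bx By.
exact: splitting_not_le (splitting_sym sE) By Bx.
Qed.

Lemma splitting_cover E1 E2 x : splitting E1 E2 ->
  x \in open_interval sigma tau <-> block E1 x \/ block E2 x.
Proof.
case=> [[_ _ _ EU] _ _]; apply: (iff_trans (in_intervalP x)).
rewrite -EU; split.
  case=> eta [W [+ Wn0 pW Ex]]; rewrite inE => /orP[] etaE; [left|right];
  by exists eta, W.
by case=> -[eta [W [etaE Wn0 pW Ex]]]; exists eta, W; rewrite inE etaE ?orbT.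
Qed.

Lemma splitting_disconnected E1 E2 : 1 < size tau - size sigma ->
  splitting E1 E2 -> disconnected_interval sigma tau.
Proof.
move=> d_gt1 sE.
have block_nonempty F1 F2 : splitting F1 F2 -> exists x, block F1 x.
  move=> sF; have [[/set0Pn[eta F1eta] _ _ _] _ _] := sF.
  have := card_zero_set (splitting_sub sF F1eta) => cardZ.
  have /card_gt0P[i Zi] : 0 < #|zero_set eta| by rewrite cardZ ltnW.
  exists (deletion [set i]), eta, [set i]; split=> //.
    by rewrite -card_gt0 cards1.
  by rewrite properEcard sub1set Zi cards1 cardZ.
exists (block E1), (block E2); split.
- by split; [apply: block_nonempty sE | apply: block_nonempty (splitting_sym sE)].
- move=> x [B1 B2]; have := splitting_incomparable sE B1 B2.
  by rewrite comparablexx.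
- by move=> x; apply: splitting_cover.
- by move=> x y; apply: splitting_incomparable.
Qed.

Lemma deletions_from_block E1 E2 x : splitting E1 E2 ->
  deletions_from sigma (zero_union E2) x -> block E2 x.
Proof.
move=> sE [xI [S sS /deletionE[SnT Ex]]]; move: xI; rewrite Ex inE.
case/andP=> ltsx ltxt; have [eta etaE sSZ] := embedding_above SnT (ltW ltsx).
have Sn0 : S != set0.
  by apply: contraTneq ltxt => ->; rewrite deletion0 ltxx.
exists eta, S; split=> //.
  have [i Si] := set0Pn _ Sn0.
  by apply: (splitting_side sE etaE (subsetP sSZ i Si)); apply: (subsetP sS).
rewrite properEneq sSZ andbT; apply: contraTneq ltsx => ->.
by have [_ {1}->] := embedding_deletion etaE; rewrite ltxx.
Qed.

Lemma splitting_disconnected_from E1 E2 : splitting E1 E2 ->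
  disconnected_from sigma tau
    (deletions_from sigma (zero_union E1))
    (deletions_from sigma (zero_union E2)).
Proof.
move=> sE x y /(deletions_from_block (splitting_sym sE)) B1.
move=> /(deletions_from_block sE) B2 [p [pI xp Ey]].
suff : block E1 y.
  by move/(splitting_incomparable sE)/(_ B2); rewrite comparablexx.
move: pI => /= /andP[_].
elim: p x B1 xp Ey => [|a p IHp] x B1 /=; first by move=> _ <-.
case/andP=> cxa ap Ey /andP[aI pI]; apply: (IHp a) => //.
case: (splitting_cover a sE) => /(_ aI)[//|Ba _].
by have := splitting_incomparable sE B1 Ba; rewrite cxa.
Qed.

(** * From a disconnection to a splitting *)

(** Both tau - {i} and tau - {j} lie above tau - {i, j}, which is still strictly
    above sigma because at least three letters are deleted to reach sigma. *)
Lemma singletons_connected (A B : permutation -> Prop) eta i j :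
  2 < size tau - size sigma -> eta \in embeddings sigma tau ->
  (forall x, x \in open_interval sigma tau <-> A x \/ B x) ->
  (forall x y, A x -> B y -> (x >< y)%O) ->
  i \in zero_set eta -> j \in zero_set eta ->
  A (deletion [set i]) -> A (deletion [set j]).
Proof.
move=> d_gt2 etaE coverAB incAB Zi Zj Ai.
have cardZ := card_zero_set etaE.
have [ZnT _] := embedding_deletion etaE.
have Wn0 k : k |: [set i] != set0 by apply/set0Pn; exists k; rewrite setU11.
have pW k : k \in zero_set eta -> k |: [set i] \proper zero_set eta.
  move=> Zk; rewrite properEcard subUset !sub1set Zk Zi cardZ.
  by apply: leq_ltn_trans d_gt2; rewrite cardsU1 cards1; case: (_ \notin _).
have step x y : A x -> y \in open_interval sigma tau -> (x >=< y)%O -> A y.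
  by move=> Ax /coverAB[//|By]; have /negP := incAB _ _ Ax By.
have [nT ijI] := deletion_in_interval etaE (Wn0 j) (pW j Zj).
have jn0 : [set j] != set0 by apply/set0Pn; exists j; rewrite set11.
have pj : [set j] \proper zero_set eta.
  by apply: sub_proper_trans (pW j Zj); rewrite subsetUl.
have [_ jI] := deletion_in_interval etaE jn0 pj.
apply: (step (deletion (j |: [set i]))) => //; last first.
  by apply: le_comparable; apply: deletion_le nT _; apply: subsetUl.
apply: (step (deletion [set i])) => //.
by apply: ge_comparable; apply: deletion_le nT _; apply: subsetUr.
Qed.

Lemma disconnected_splitting : 2 < size tau - size sigma ->
  disconnected_interval sigma tau ->
  exists E1 E2 : {set eseq sigma tau}, splitting E1 E2.
Proof.
move=> d_gt2 [A [B [[exA exB] disjAB coverAB incAB]]].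
have coverBA x : x \in open_interval sigma tau <-> B x \/ A x.
  by apply: (iff_trans (coverAB x)); split=> -[]; [right|left|right|left].
have incBA x y : B x -> A y -> (x >< y)%O.
  by move=> Bx Ay; rewrite comparable_sym incAB.
(* b records which of the two parts contains the block of eta. *)
have : forall eta, exists b : bool, eta \in embeddings sigma tau ->
    forall W, W != set0 -> W \proper zero_set eta ->
      (if b then A else B) (deletion W).
  move=> eta; case: (boolP (eta \in _)) => [etaE|_]; last by exists true.
  have cardZ := card_zero_set etaE.
  have /card_gt0P[i Zi] : 0 < #|zero_set eta|.
    by rewrite cardZ; apply: leq_trans d_gt2.
  have sgI j : j \in zero_set eta ->
      deletion [set j] \in open_interval sigma tau.
    move=> Zj; have [||//] := @deletion_in_interval eta [set j] etaE.
      by apply/set0Pn; exists j; rewrite set11.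
    by rewrite properEcard sub1set Zj cards1 cardZ ltnW.
  have below (A' B' : permutation -> Prop) :
      (forall x, x \in open_interval sigma tau <-> A' x \/ B' x) ->
      (forall x y, A' x -> B' y -> (x >< y)%O) ->
      A' (deletion [set i]) ->
      forall W, W != set0 -> W \proper zero_set eta -> A' (deletion W).
    move=> cov inc Ai W Wn0 pW; have [j Wj] := set0Pn _ Wn0.
    have Zj := subsetP (proper_sub pW) j Wj.
    have Aj := singletons_connected d_gt2 etaE cov inc Zi Zj Ai.
    have [WnT /cov[//|BW]] := deletion_in_interval etaE Wn0 pW.
    have /negP[] := inc _ _ Aj BW.
    by apply: ge_comparable; apply: deletion_le WnT _; rewrite sub1set.
  case/coverAB: (sgI i Zi) => [Ai|Bi]; [exists true | exists false] => _.
    exact: below coverAB incAB Ai.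
  exact: below coverBA incBA Bi.
case/fin_all_exists=> b bP.
have sideA eta W : eta \in embeddings sigma tau -> W != set0 ->
  W \proper zero_set eta -> b eta -> A (deletion W).
  by move=> etaE Wn0 pW b_eta; have := bP eta etaE W Wn0 pW; rewrite b_eta.
have sideB eta W : eta \in embeddings sigma tau -> W != set0 ->
  W \proper zero_set eta -> ~~ b eta -> B (deletion W).
  move=> etaE Wn0 pW /negbTE b_eta.
  by have := bP eta etaE W Wn0 pW; rewrite b_eta.
exists [set eta in embeddings sigma tau | b eta].
exists [set eta in embeddings sigma tau | ~~ b eta].
split.
- split.
  + have [x Ax] := exA; have /in_intervalP := (coverAB x).2 (or_introl Ax).
    case=> eta [W [etaE Wn0 pW Ex]]; apply/set0Pn; exists eta.
    rewrite inE etaE; case: (boolP (b eta)) => // /(sideB _ _ etaE Wn0 pW).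
    by rewrite -Ex => Bx; case: (disjAB x).
  + have [x Bx] := exB; have /in_intervalP := (coverAB x).2 (or_intror Bx).
    case=> eta [W [etaE Wn0 pW Ex]]; apply/set0Pn; exists eta.
    rewrite inE etaE; case: (boolP (b eta)) => // /(sideA _ _ etaE Wn0 pW).
    by rewrite -Ex => Ax; case: (disjAB x).
  + by apply/setP=> eta; rewrite !inE; case: (b eta); rewrite /= ?andbF.
  + apply/setP=> eta; rewrite !inE.
    by case: (b eta); rewrite /= ?andbF ?andbT ?orbF.
- apply/setP=> i; rewrite !inE; apply/negbTE/negP=> /andP[].
  case/bigcupP=> eta1; rewrite inE => /andP[eta1E b1] Zi1.
  case/bigcupP=> eta2; rewrite inE => /andP[eta2E b2] Zi2.
  have in0 : [set i] != set0 by apply/set0Pn; exists i; rewrite set11.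
  have pi eta : eta \in embeddings sigma tau -> i \in zero_set eta ->
      [set i] \proper zero_set eta.
    move=> etaE Zi; rewrite properEcard sub1set Zi cards1.
    by rewrite (card_zero_set etaE) ltnW.
  apply: (disjAB (deletion [set i])); split.
    exact: (sideA eta1) (pi _ _ _) _.
  exact: (sideB eta2) (pi _ _ _) _.
move=> eta1 eta2; rewrite inE => /andP[eta1E b1].
rewrite inE => /andP[eta2E b2] [z1 [z2 [Z1z Z2z Edel]]].
have D1n0 eta z : eta \in embeddings sigma tau -> z \in zero_set eta ->
    zero_set eta :\ z != set0.
  move=> etaE Zz; have := card_zero_set etaE.
  rewrite (cardsD1 z) Zz add1n -card_gt0 => cardZ.
  by rewrite -ltnS cardZ ltnW.
have A1 := sideA eta1 _ eta1E (D1n0 _ _ eta1E Z1z) (properD1 Z1z) b1.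
have B2 := sideB eta2 _ eta2E (D1n0 _ _ eta2E Z2z) (properD1 Z2z) b2.
by apply: (disjAB _ (conj A1 _)); rewrite /deletion Edel.
Qed.

End Interval.

Theorem proposition5p3 (sigma tau : permutation)
  (lt_sigma_tau : (sigma < tau)%O)
  (size_diff : 3 <= size tau - size sigma) :
  (disconnected_interval sigma tau <->
     exists E1 E2 : {set eseq sigma tau}, splitting E1 E2)
  /\
  (forall E1 E2 : {set eseq sigma tau}, splitting E1 E2 ->
     disconnected_from sigma tau
       (deletions_from sigma (zero_union E1))
       (deletions_from sigma (zero_union E2))).
Proof.
split; last exact: splitting_disconnected_from.
split; first exact: disconnected_splitting.
by case=> E1 [E2 sE]; apply: splitting_disconnected sE; apply: ltnW.
Qed.
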